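(* Let $M$ be a convex set of equivalent measures and let $\{f_m,\mathcal F_m\}_{m=0}^\infty$ be a supermartingale relative to $M$ with $\sup_{P\in M}E^P|f_m|<\infty$ for all $m=0,1,2,\dots$, for which the representation $$f_m=M_m-g^0_m,\qquad m=0,1,2,\dots,$$ is valid, where $\{M_m\}_{m=0}^\infty$ is a martingale relative to $M$ such that $E^P|M_m|<\infty$ for $m\ge0$, $P\in M$, and $g^0=\{g^0_m\}_{m=0}^\infty$, $g^0_0=0$, is a non-decreasing adapted process. Then $\{f_m,\mathcal F_m\}_{m=0}^\infty$ is a local regular supermartingale.
   Context: $(\Omega,\mathcal F)$ is a measurable space with a filtration $\mathcal F_m\subset\mathcal F_{m+1}\subset\mathcal F$, $m\ge0$, and $\mathcal F_0=\{\emptyset,\Omega\}$. All measures are probability measures; equivalent means mutually absolutely continuous. $E^P$ denotes (conditional) expectation with respect to $P$; relations between random variables hold almost surely. An adapted process $\{f_m\}_{m=0}^\infty$ is a supermartingale relative to a family of measures $M$ if $E^P|f_m|<\infty$ for $m\ge1$, $P\in M$, and $E^P\{f_m|\mathcal F_k\}\le f_k$ for $0\le k\le m$, $P\in M$; it is a martingale relative to $M$ if these inequalities are equalities. Sets of adapted non-decreasing processes starting at $0$ are partially ordered by: $g_1\preceq g_2$ iff $P(g^2_m-g^1_m\ge0)=1$ for all $m\ge1$, where $g_i=\{g^i_m\}$; (maximal) chains and maximal elements refer to $\preceq$. Regular supermartingale. Let $\{f_m,\mathcal F_m\}_{m=0}^\infty$ be a supermartingale relative to a convex set of equivalent measures $M$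 such that $|f_m|\le\varphi$ for all $m\ge0$ and $E^Q\varphi<T<\infty$ for all $Q\in M$, with a random variable $\varphi$ and a real number $T$ not depending on $Q\in M$. It is called regular if there exists an adapted nonnegative process $\bar g^0=\{\bar g^0_m\}_{m=0}^\infty$, $\bar g^0_0=0$, $E^P\bar g^0_m<\infty$ ($m\ge1$, $P\in M$), such that for every finite family $\hat P_1,\dots,\hat P_s\in M$ satisfying $0<l\le\frac{d\hat P_i}{d\hat P_j}\le L<\infty$, $i,j=1,\dots,s$ (with $l,L$ real numbers depending on the family), the following hold. Put $\hat M_s=\{\sum_{i=1}^s\gamma_i\hat P_i:\gamma_i\ge0,\sum_{i=1}^s\gamma_i=1\}$ and let $G_s$ be the set of adapted non-decreasing processes $\{g_m\}_{m=0}^\infty$, $g_0=0$, for which $\{f_m+g_m\}_{m=0}^\infty$ is a supermartingale relative to all measures from $\hat M_s$. (i) There exist a natural number $1\le m_0<\infty$ and an $\mathcal F_{m_0-1}$-measurable nonnegative random variable $\varphi^s_{m_0}$ with $\hat P_1(\varphi^s_{m_0}>0)>0$ such that $f_{m_0-1}-E^{\hat P_i}\{f_{m_0}|\mathcal F_{m_0-1}\}\ge\varphi^s_{m_0}$, $i=1,\dots,s$. (ii) For the maximal element $g^s=\{g^s_m\}_{m=0}^\infty$ in a certain maximal chain $\tilde G_s\subseteq G_s$, $E^{\hat P_i}\{f_m+g^s_m|\mathcal F_k\}=f_k+g^s_k$ for $0\le k\le m$, $m\ge1$, $i=1,\dots,s$. (iii) $E^{\hat P_i}\{g^s_m-g^s_{m-1}|\mathcal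 F_{m-1}\}=E^{\hat P_i}\{\bar g^0_m|\mathcal F_{m-1}\}$ for $m\ge1$, $i=1,\dots,s$. Local regular supermartingale. A supermartingale $\{f_m,\mathcal F_m\}_{m=0}^\infty$ relative to $M$ with $\sup_{P\in M}E^P|f_m|<\infty$ for all $m\ge0$ is called local regular if there exists an increasing sequence of nonrandom stopping times $\tau_{k_s}=k_s<\infty$, $s=1,2,\dots$, $\lim_{s\to\infty}k_s=\infty$, such that for every $s$ the stopped process $\{f_{m\wedge\tau_{k_s}},\mathcal F_m\}_{m=0}^\infty$ is a regular supermartingale.
   Formalization: The formal theorem additionally assumes that f is not a martingale relative to M; if f is a martingale and M is non-empty (e.g. f = 0), condition (i) of regularity fails for a one-element family, so the claim as stated is false there. *)

(* Defs.v *)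
From HB Require Import structures.
From mathcomp Require Import all_boot all_order all_algebra.
From mathcomp Require Import all_classical all_reals all_analysis measurable_realfun.

Set Implicit Arguments.
Unset Strict Implicit.
Unset Printing Implicit Defensive.

Import Order.TTheory GRing.Theory Num.Theory.
Import numFieldNormedType.Exports.

Local Open Scope classical_set_scope.
Local Open Scope ring_scope.
Local Open Scope ereal_scope.
Local Open Scope charge_scope.

Section conditional_expectation.
Context (d : measure_display) (T : measurableType d) (R : realType).
Implicit Types (P : probability T R) (G : set (set T)) (X Y : T -> R).

Definition measurable_wrt G X :=
  measurable_fun [set: g_sigma_algebraType G] (X : g_sigma_algebraType G -> R).

Definition is_cexp P G X Y :=
  [/\ measurable_wrt G Y, P.-integrable [set: T] (EFin \o Y) &
      forall A, G A -> \int[P]_(x in A) (Y x)%:E = \int[P]_(x in A) (X x)%:E].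

(* A version of E^P{X | G}; the default value is used only when X has no
   conditional expectation, which cexpP excludes for integrable X. *)
Definition cexp P G X : T -> R := xget (cst 0%R) [set Y | is_cexp P G X Y].

End conditional_expectation.

Definition sub_measure (d : measure_display) (T : measurableType d)
    (R : realType) (P : probability T R) (G : set (set T))
    of sigma_algebra [set: T] G & G `<=` measurable :
  set (g_sigma_algebraType G) -> \bar R :=
  pushforward P (id : T -> g_sigma_algebraType G).

Definition sub_charge (d : measure_display) (T : measurableType d)
    (R : realType) (P : probability T R) (G : set (set T)) (X : T -> R)
    (intX : P.-integrable [set: T] (EFin \o X))
    of sigma_algebra [set: T] G & G `<=` measurable :
  set (g_sigma_algebraType G) -> \bar R :=
  pushforward (induced_charge intX) (id : T -> g_sigma_algebraType G).

Section cexp_existence.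
Context (d : measure_display) (T : measurableType d) (R : realType).
Variables (P : probability T R) (G : set (set T)) (X : T -> R).
Hypothesis sG : sigma_algebra [set: T] G.
Hypothesis GT : G `<=` measurable.
Hypothesis intX : P.-integrable [set: T] (EFin \o X).

Let S := g_sigma_algebraType G.

Let measSE : @measurable _ S = G.
Proof. exact: sigma_algebra_id. Qed.

Let measS (A : set S) : measurable A -> (@measurable _ T) A.
Proof. by rewrite measSE; exact: GT. Qed.

Let idS : T -> S := id.

Let midS : measurable_fun [set: T] idS.
Proof. by move=> _ A mA; rewrite setTI; exact: (measS mA). Qed.

Local Notation mu := (sub_measure P sG GT).
Let mu0 : mu set0 = 0. Proof. exact: measure0. Qed.
Let mu_ge0 A : 0 <= mu A. Proof. exact: measure_ge0. Qed.
Let mu_sadd : semi_sigma_additive mu.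
Proof. exact: (@measure_semi_sigma_additive _ _ _ (pushforward P idS)). Qed.
HB.instance Definition _ := isMeasure.Build _ _ _ mu mu0 mu_ge0 mu_sadd.
Let mu_setT : mu setT = 1. Proof. exact: probability_setT. Qed.
HB.instance Definition _ := Measure_isProbability.Build _ _ _ mu mu_setT.

Local Notation nu := (sub_charge intX sG GT).
Let nu0 : nu set0 = 0. Proof. exact: charge0. Qed.
Let nu_fin A : measurable A -> nu A \is a fin_num.
Proof. exact: (@fin_num_measure _ _ _ (pushforward (induced_charge intX) idS)). Qed.
Let nu_sadd : semi_sigma_additive nu.
Proof.
exact: (@charge_semi_sigma_additive _ _ _ (pushforward (induced_charge intX) idS)).
Qed.
HB.instance Definition _ := isCharge.Build _ _ _ nu nu0 nu_fin nu_sadd.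

Let nu_mu : nu `<< mu.
Proof.
apply: dominates_pushforward; first exact: midS.
apply/null_content_dominatesP => A mA PA0.
rewrite /induced_charge; apply: null_set_integral => //.
exact: measurable_funS (measurable_int P intX).
Qed.

Let g : S -> \bar R := 'd nu '/d mu.

Let gE x : (fine (g x))%:E = g x.
Proof. by rewrite fineK// Radon_Nikodym_fin_num. Qed.

Lemma cexpP : is_cexp P G X (cexp P G X).
Proof.
have ig : mu.-integrable [set: S] g by exact: Radon_Nikodym_integrable.
have mg : measurable_fun [set: S] g by exact: measurable_int ig.
have igT : P.-integrable [set: T] (g \o idS).
  apply/integrableP; split.
    move=> _ B mB; rewrite setTI; apply: measS.
    by have := mg measurableT _ mB; rewrite setTI.
  case/integrableP: ig => _; apply: le_lt_trans.
  by rewrite /sub_measure ge0_integral_pushforward//; exact: measurableT_comp mg.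
rewrite /cexp; case: xgetP => [Y _ //|/(_ (fine \o g))[]].
split=> [||A GA].
- exact: measurableT_comp mg.
- by have -> : EFin \o (fine \o g) = g by apply/funext => x /=; rewrite gE.
- have mA : measurable (A : set S) by rewrite measSE.
  under eq_integral do rewrite /= gE.
  have /= <- := @integral_pushforward _ _ T S R idS midS P A g mg _ mA; last first.
    by apply: integrableS igT => //; exact: measS.
  by rewrite -[LHS](Radon_Nikodym_integral nu_mu mA).
Qed.

End cexp_existence.

Section processes.
Context (d : measure_display) (T : measurableType d) (R : realType).
Implicit Types (F : nat -> set (set T)) (M : set (probability T R)).
Implicit Types (f g : nat -> T -> R).

Definition filtration F :=
  [/\ forall m, sigma_algebra [set: T] (F m),
      forall m, F m `<=` F m.+1,
      forall m, F m `<=` measurable &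
      F 0%N = [set set0; [set: T]]].

(* A probability is here a function on all subsets of T, so a mixture is
   determined only by its values on the measurable sets. *)
Definition convex_measures M :=
  forall P Q, M P -> M Q -> forall t : R, (0 <= t <= 1)%R ->
  exists2 N : probability T R, M N &
    forall A, measurable A -> N A = t%:E * P A + (1 - t)%:E * Q A.

Definition equivalent_measures M := forall P Q, M P -> M Q -> P `<< Q.

Definition adapted F f := forall m, measurable_wrt (F m) (f m).

Definition supermartingale F M f :=
  [/\ adapted F f,
      forall m P, (1 <= m)%N -> M P -> P.-integrable [set: T] (EFin \o f m) &
      forall k m P, (k <= m)%N -> M P ->
        {ae P, forall x, (cexp P (F k) (f m) x <= f k x)%R}].

Definition martingale F M f :=
  [/\ adapted F f,
      forall m P, (1 <= m)%N -> M P -> P.-integrable [set: T] (EFin \o f m) &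
      forall k m P, (k <= m)%N -> M P ->
        {ae P, forall x, cexp P (F k) (f m) x = f k x}].

Definition nondecreasing_process F M g :=
  [/\ adapted F g,
      forall P, M P -> {ae P, forall x, g 0%N x = 0%R} &
      forall m P, M P -> {ae P, forall x, (g m x <= g m.+1 x)%R}].

Definition process_le M g1 g2 :=
  forall m P, (1 <= m)%N -> M P -> P [set x | (0 <= g2 m x - g1 m x)%R] = 1.

Definition maximal_chain (U : Type) (r : U -> U -> Prop) (G C : set U) :=
  [/\ C `<=` G, total_on C r &
      forall C', C' `<=` G -> total_on C' r -> C `<=` C' -> C' `<=` C].

Definition maximal_element (U : Type) (r : U -> U -> Prop) (C : set U) (g : U) :=
  C g /\ forall h, C h -> r g h -> r h g.

(* The family P_1, ..., P_s with s >= 1 is indexed by 'I_s'.+1, s = s'.+1, so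
   that P_1 is Ps ord0. *)
Definition bounded_densities (s : nat) (Ps : 'I_s.+1 -> probability T R) :=
  exists l L : R, (0 < l)%R /\ forall i j,
    {ae Ps j, forall x,
      l%:E <= ('d (charge_of_finite_measure (Ps i)) '/d (Ps j)) x <= L%:E}.

Definition mixtures (s : nat) (Ps : 'I_s.+1 -> probability T R) :
    set (probability T R) :=
  [set Q | exists c : 'I_s.+1 -> R,
    [/\ forall i, (0 <= c i)%R, (\sum_i c i = 1)%R &
        forall A, measurable A -> Q A = \sum_i (c i)%:E * Ps i A]].

Definition compensators F (s : nat) (Ps : 'I_s.+1 -> probability T R) f :
    set (nat -> T -> R) :=
  [set g | nondecreasing_process F (mixtures Ps) g /\
    supermartingale F (mixtures Ps) (fun m => f m \+ g m)%R].

Definition strict_decrease F (s : nat) (Ps : 'I_s.+1 -> probability T R) f :=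
  exists m0 (phi : T -> R), [/\ (1 <= m0)%N, measurable_wrt (F m0.-1) phi,
    forall i, {ae Ps i, forall x, (0 <= phi x)%R},
    0 < Ps ord0 [set x | (0 < phi x)%R] &
    forall i, {ae Ps i, forall x,
      (phi x <= f m0.-1 x - cexp (Ps i) (F m0.-1) (f m0) x)%R}].

Definition compensated F (s : nat) (Ps : 'I_s.+1 -> probability T R) f gbar :=
  exists (C : set (nat -> T -> R)) (g : nat -> T -> R),
  [/\ maximal_chain (process_le (mixtures Ps)) (compensators F Ps f) C,
      maximal_element (process_le (mixtures Ps)) C g,
      forall i k m, (k <= m)%N -> (1 <= m)%N ->
        {ae Ps i, forall x,
          cexp (Ps i) (F k) (f m \+ g m)%R x = (f k x + g k x)%R} &
      forall i m, (1 <= m)%N ->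
        {ae Ps i, forall x, cexp (Ps i) (F m.-1) (g m \- g m.-1)%R x =
                            cexp (Ps i) (F m.-1) (gbar m) x}].

Definition regular_supermartingale F M f :=
  [/\ convex_measures M /\ equivalent_measures M,
      supermartingale F M f,
      exists (phi : T -> R) (t : R), [/\ measurable_fun [set: T] phi,
        forall m P, M P -> {ae P, forall x, (`|f m x| <= phi x)%R} &
        forall P, M P -> 'E_P[phi] < t%:E] &
      exists gbar : nat -> T -> R,
        [/\ adapted F gbar,
            forall m P, M P -> {ae P, forall x, (0 <= gbar m x)%R},
            forall P, M P -> {ae P, forall x, gbar 0%N x = 0%R},
            forall m P, (1 <= m)%N -> M P ->
              P.-integrable [set: T] (EFin \o gbar m) &
            forall (s : nat) (Ps : 'I_s.+1 -> probability T R),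
              (forall i, M (Ps i)) -> bounded_densities Ps ->
              strict_decrease F Ps f /\ compensated F Ps f gbar]].

Definition stopped (tau : T -> nat) f : nat -> T -> R :=
  fun m x => f (minn m (tau x)) x.

Definition bounded_means M f :=
  forall m, ereal_sup [set 'E_P[fun x => `|f m x|%R] | P in M] < +oo.

Definition local_regular F M f :=
  [/\ supermartingale F M f, bounded_means M f &
      exists k : nat -> nat,
        [/\ {homo k : s t / (s < t)%N}, k @ \oo --> \oo &
            forall s, regular_supermartingale F M (stopped (cst (k s)) f)]].

End processes.

(* Main.v *)
Require Import Defs.
From HB Require Import structures.
From mathcomp Require Import all_boot all_order all_algebra.
From mathcomp Require Import all_classical all_reals all_analysis measurable_realfun.

(** Write [N] for a nonrandom stopping time. The stopped process
[f_(m /\ N) = mart_(m /\ N) - g0_(m /\ N)] inherits the decomposition, and the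
process [gbar] of regularity is taken to be the increments
[g0_(m /\ N) - g0_((m-1) /\ N)], for all families of measures at once. Three
points have to be settled.

Domination. Up to time [N] the process is bounded by [|f_0| + ... + |f_N|], and
[bounded_means] bounds its expectation uniformly over [M]
([stopped_dominated]).

Compensation. Given a finite family in [M], a mixture of it agrees on measurable
sets with an element of [M], by convexity ([mixtures_convex]). So [f + g], with
[g] the stopped [g0], is a martingale under all mixtures, and [g] is a
compensator. It is maximal among all compensators: if [g <= h] and [f + h] is a
supermartingale, then [E(f_m + h_m) <= f_0 = E(f_m + g_m)] forces [h = g]
([martingale_compensator_maximal]). By Zorn's lemma some maximal chain passes
through [g] ([maximal_chain_through]), and [g] is its maximal element.

Strict decrease. If all increments of [g0] vanished almost surely, [f] would
coincide with the martingale; hence some increment [g0_(m+1) - g0_m] is not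
null ([not_martingale_jump]). The decrease [f_m - E^P(f_(m+1) | F_m)] is a
version of [E^P(g0_(m+1) - g0_m | F_m)] ([is_cexp_decrease]). Where such a conditional
expectation vanishes, the nonnegative increment itself vanishes almost surely,
for [P] and thus for all the equivalent measures; so the minimum of
finitely many of them is still positive with positive probability
([cexp_common_lower_bound]). Any [N > m] then works, and the localizing
sequence is [m + 1, m + 2, ...]. *)

Set Implicit Arguments.
Unset Strict Implicit.
Unset Printing Implicit Defensive.

Import Order.TTheory GRing.Theory Num.Theory.

Local Open Scope classical_set_scope.
Local Open Scope ring_scope.
Local Open Scope ereal_scope.

(** * Almost sure relations and integrals *)

Section measurability.
Context (d : measure_display) (T : measurableType d) (R : realType).
Implicit Types (P : probability T R) (G : set (set T)) (X Y : T -> R).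

Lemma measurable_wrtT G X : G `<=` measurable -> measurable_wrt G X ->
  measurable_fun [set: T] X.
Proof.
move=> GT mX _ A mA; have sG : <<s G >> `<=` @measurable _ T.
  apply: smallest_sub => //; exact: sigma_algebra_measurable.
exact: (sG _ (mX measurableT _ mA)).
Qed.

Lemma measurable_wrt_sub G G' X : G `<=` G' -> measurable_wrt G X ->
  measurable_wrt G' X.
Proof.
by move=> GG' mX _ A mA; have := sub_sigma_algebra2 GG' (mX measurableT _ mA).
Qed.

Lemma measurable_wrt_lt G X Y : sigma_algebra [set: T] G ->
  measurable_wrt G X -> measurable_wrt G Y -> G [set x | (X x < Y x)%R].
Proof.
move=> sG mX mY; have := measurable_fun_ltr mX mY measurableT (Y := [set true]).
have measE : @measurable _ (g_sigma_algebraType G) = G.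
  exact: sigma_algebra_id.
rewrite setTI => /(_ I); rewrite measE; exact.
Qed.

Lemma integrable_ae_eq P X Y : measurable_fun [set: T] Y ->
  {ae P, forall x, X x = Y x} ->
  P.-integrable [set: T] (EFin \o X) -> P.-integrable [set: T] (EFin \o Y).
Proof.
move=> mY XY /integrableP[mX iX]; apply/integrableP; split.
  exact/measurable_EFinP.
rewrite (le_lt_trans _ iX)//; apply: ae_ge0_le_integral => //.
- by apply: measurableT_comp => //; exact/measurable_EFinP.
- exact: measurableT_comp.
- by apply: filterS XY => x /= ->.
Qed.

Lemma probability1_ge0P P X : measurable_fun [set: T] X ->
  P [set x | (0 <= X x)%R] = 1 <-> {ae P, forall x, (0 <= X x)%R}.
Proof.
move=> mX; have mA : measurable [set x | (0 <= X x)%R].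
  have m0 : measurable_fun [set: T] (cst 0%R : T -> R) by exact: measurable_cst.
  have := measurable_fun_ler m0 mX measurableT (Y := [set true]) I.
  by rewrite setTI.
suff -> : {ae P, forall x, (0 <= X x)%R} <-> P (~` [set x | (0 <= X x)%R]) = 0.
  split=> [PA|PA0]; first by rewrite probability_setC// PA subee.
  rewrite -[X in P X]setCK probability_setC ?PA0 ?sube0//.
  exact: measurableC.
by apply: negligibleP; exact: measurableC.
Qed.

Lemma ae_ge0_integral_abs P (D : set T) X : measurable D ->
  measurable_fun D X -> {ae P, forall x, D x -> (0 <= X x)%R} ->
  \int[P]_(x in D) `|(X x)%:E| = \int[P]_(x in D) (X x)%:E.
Proof.
move=> mD mX X0; apply: ae_eq_integral => //.
- by apply: measurableT_comp => //; exact/measurable_EFinP.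
- exact/measurable_EFinP.
- by apply: filterS X0 => x h Dx; rewrite /= ger0_norm// h.
Qed.

Lemma ae_le_integral P X Y : P.-integrable [set: T] (EFin \o X) ->
  P.-integrable [set: T] (EFin \o Y) -> {ae P, forall x, (X x <= Y x)%R} ->
  \int[P]_x (X x)%:E <= \int[P]_x (Y x)%:E.
Proof.
move=> iX iY XY.
have ge0 : 0 <= \int[P]_x ((Y \- X)%R x)%:E.
  rewrite -ae_ge0_integral_abs ?integral_ge0//.
    apply: measurable_funB; apply/measurable_EFinP.
      exact: measurable_int iY.
    exact: measurable_int iX.
  by apply: filterS XY => x + _; rewrite /= subr_ge0.
rewrite -sube_ge0; last by apply/orP; right; exact: integrable_fin_num iY.
by rewrite -integralB_EFin.
Qed.

(** How an inequality between expectations becomes an almost sure equality: a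
   nonnegative variable whose integral is not positive is null. *)
Lemma integral_le0_ae_eq0 P (D : set T) X : measurable D ->
  P.-integrable [set: T] (EFin \o X) ->
  {ae P, forall x, D x -> (0 <= X x)%R} ->
  \int[P]_(x in D) (X x)%:E <= 0 -> {ae P, forall x, D x -> X x = 0%R}.
Proof.
move=> mD iX X0 le0.
have mX : measurable_fun D (EFin \o X).
  by apply: measurable_funS (measurable_int _ iX).
have e := ae_ge0_integral_abs mD (proj1 (measurable_EFinP _ _) mX) X0.
have : \int[P]_(x in D) `|(EFin \o X) x| = 0.
  by apply/eqP; rewrite eq_le integral_ge0// andbT e.
move/(ae_eq_integral_abs _ mD mX); apply: filterS => x h Dx.
by have [] := h Dx.
Qed.

(** Tested on the [G]-set where the inequality fails. *)
Lemma ae_le_of_integral P G X Y : sigma_algebra [set: T] G ->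
  G `<=` measurable -> measurable_wrt G X -> measurable_wrt G Y ->
  P.-integrable [set: T] (EFin \o X) -> P.-integrable [set: T] (EFin \o Y) ->
  (forall A, G A -> \int[P]_(x in A) (X x)%:E <= \int[P]_(x in A) (Y x)%:E) ->
  {ae P, forall x, (X x <= Y x)%R}.
Proof.
move=> sG GT mX mY iX iY XY.
have GA := measurable_wrt_lt sG mY mX.
have mA := GT _ GA.
have iS Z : P.-integrable [set: T] (EFin \o Z) ->
    P.-integrable [set x | (Y x < X x)%R] (EFin \o Z).
  by apply: integrableS.
have : {ae P, forall x, [set x | (Y x < X x)%R] x -> (X \- Y)%R x = 0%R}.
  apply: integral_le0_ae_eq0 => //.
  - by apply: eq_integrable (integrableB _ iX iY).
  - by apply: aeW => x /= h; rewrite subr_ge0 ltW.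
  - under eq_integral do rewrite /= EFinB.
    rewrite integralB_EFin//; [|exact: iS..].
    rewrite sube_le0; exact: XY.
apply: filterS => x h; rewrite leNgt; apply/negP => lt.
by have /eqP := h lt; rewrite /= subr_eq0 => /eqP e; rewrite e ltxx in lt.
Qed.

End measurability.

(** * Conditional expectations *)

Section conditional_expectations.
Context (d : measure_display) (T : measurableType d) (R : realType).
Variables (G : set (set T)).
Hypotheses (sG : sigma_algebra [set: T] G) (GT : G `<=` measurable).
Implicit Types (P Q : probability T R) (X Y : T -> R).

Lemma is_cexp_unique P X Y Z : is_cexp P G X Y -> is_cexp P G X Z ->
  {ae P, forall x, Y x = Z x}.
Proof.
move=> [mY iY eY] [mZ iZ eZ].
have YZ : {ae P, forall x, (Y x <= Z x)%R}.
  by apply: (ae_le_of_integral sG) => // A GA; rewrite eY// eZ.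
have ZY : {ae P, forall x, (Z x <= Y x)%R}.
  by apply: (ae_le_of_integral sG) => // A GA; rewrite eY// eZ.
by apply: filterS2 YZ ZY => x a b; apply/eqP; rewrite eq_le a b.
Qed.

Lemma cexp_unique P X Y : is_cexp P G X Y ->
  {ae P, forall x, cexp P G X x = Y x}.
Proof.
move=> XY; apply: is_cexp_unique (XY).
by rewrite /cexp; case: xgetP => [//|/(_ Y)].
Qed.

Lemma is_cexp_ae P X Y Z : is_cexp P G X Y -> {ae P, forall x, Y x = Z x} ->
  measurable_wrt G Z -> is_cexp P G X Z.
Proof.
move=> [mY iY eY] YZ mZ.
have TY := measurable_wrtT GT mY; have TZ := measurable_wrtT GT mZ.
split=> //; first exact: integrable_ae_eq iY.
move=> A GA; rewrite -eY//; apply: ae_eq_integral.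
- exact: GT.
- exact/measurable_EFinP/measurable_funTS.
- exact/measurable_EFinP/measurable_funTS.
- by apply: filterS YZ => x /= ->.
Qed.

(** An equality of functions, not just of almost sure classes: both sides are
   the same choice in the same set of versions. *)
Lemma cexp_ae P X Y : measurable_fun [set: T] X -> measurable_fun [set: T] Y ->
  {ae P, forall x, X x = Y x} -> cexp P G X = cexp P G Y.
Proof.
move=> mX mY XY; rewrite /cexp; congr xget; apply/seteqP.
have e A : G A -> \int[P]_(x in A) (X x)%:E = \int[P]_(x in A) (Y x)%:E.
  move=> GA; apply: ae_eq_integral.
  - exact: GT.
  - exact/measurable_EFinP/measurable_funTS.
  - exact/measurable_EFinP/measurable_funTS.
  - by apply: filterS XY => x /= ->.
by split=> Z [mZ iZ eZ]; split=> // A GA; rewrite eZ// e.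
Qed.

(** A probability is a function on all subsets, so two probabilities with the
   same values on measurable sets need not be equal. They have the same
   integrals, which is all that conditional expectations depend on. *)
Lemma integrable_agree P Q X : (forall A, measurable A -> P A = Q A) ->
  P.-integrable [set: T] (EFin \o X) -> Q.-integrable [set: T] (EFin \o X).
Proof.
move=> PQ /integrableP[mX iX]; apply/integrableP; split=> //.
by rewrite (@eq_measure_integral _ _ _ _ P)// => A mA _; exact/esym/PQ.
Qed.

Lemma cexp_agree P Q X : (forall A, measurable A -> P A = Q A) ->
  cexp P G X = cexp Q G X.
Proof.
move=> PQ; rewrite /cexp; congr xget.
have e A Z : \int[P]_(x in A) (Z x)%:E = \int[Q]_(x in A) (Z x)%:E.
  by apply: eq_measure_integral => B mB _; exact: PQ.
apply/seteqP; split=> Z [mZ iZ eZ]; split=> //;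
    try by move=> A GA; have := eZ _ GA; rewrite !e.
- exact: integrable_agree iZ.
- by apply: integrable_agree iZ => A mA; rewrite PQ.
Qed.

End conditional_expectations.

Lemma ae_agree (d : measure_display) (T : measurableType d) (R : realType)
    (P Q : probability T R) (S : set T) :
  (forall A, measurable A -> P A = Q A) -> {ae P, forall x, S x} ->
  {ae Q, forall x, S x}.
Proof. by move=> PQ [A [mA A0 SA]]; exists A; split=> //; rewrite -PQ. Qed.

Lemma ae_dominates (d : measure_display) (T : measurableType d) (R : realType)
    (P Q : probability T R) (S : set T) :
  Q `<< P -> {ae P, forall x, S x} -> {ae Q, forall x, S x}.
Proof.
move=> /null_content_dominatesP PQ [A [mA A0 SA]]; exists A; split=> //.
exact: PQ.
Qed.

(** * Processes *)

Section processes.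
Context (d : measure_display) (T : measurableType d) (R : realType).
Variables (F : nat -> set (set T)).
Hypothesis hF : filtration F.
Implicit Types (P Q N : probability T R) (M : set (probability T R)).
Implicit Types (f g h X Y : nat -> T -> R).

Lemma filtration_le k m : (k <= m)%N -> F k `<=` F m.
Proof.
case: hF => _ Fs _ _ /subnK <-; elim: (m - k)%N => [//|n ih].
exact: subset_trans ih (Fs _).
Qed.

Lemma filtration_sigma m : sigma_algebra [set: T] (F m).
Proof. by case: hF. Qed.

Lemma filtration_measurable m : F m `<=` measurable.
Proof. by case: hF => _ _ /(_ m). Qed.

Local Notation sF := (@filtration_sigma).
Local Notation mF := (@filtration_measurable).

Lemma adapted_measurable X m : adapted F X -> measurable_fun [set: T] (X m).
Proof. by move=> aX; exact: measurable_wrtT (@mF m) (aX m). Qed.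

Lemma adapted_stopped n X : adapted F X -> adapted F (stopped (cst n) X).
Proof.
move=> aX m.
exact: (measurable_wrt_sub (@filtration_le _ _ (geq_minl m n)) (aX (minn m n))).
Qed.

Lemma martingale_is_cexp M X k m P : martingale F M X ->
  P.-integrable [set: T] (EFin \o X m) -> (k <= m)%N -> M P ->
  is_cexp P (F k) (X m) (X k).
Proof.
move=> [aX _ eX] iX km MP.
exact: (is_cexp_ae (@mF k) (cexpP (sF k) (@mF k) iX) (eX _ _ _ km MP) (aX k)).
Qed.

Lemma martingale_ae M X Y : adapted F Y ->
  (forall m P, M P -> {ae P, forall x, X m x = Y m x}) ->
  martingale F M X -> martingale F M Y.
Proof.
move=> aY XY [aX iX eX]; split=> //.
- move=> m P m1 MP; apply: integrable_ae_eq (XY m _ MP) (iX _ _ m1 MP).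
  exact: adapted_measurable.
- move=> k m P km MP; rewrite -(@cexp_ae _ _ _ _ (@mF k) P (X m)).
  + by apply: filterS2 (eX _ _ _ km MP) (XY k _ MP) => x -> ->.
  + exact: adapted_measurable.
  + exact: adapted_measurable.
  + exact: XY.
Qed.

Lemma martingale_agree M M' X :
  (forall Q, M' Q -> exists2 N, M N & forall A, measurable A -> N A = Q A) ->
  martingale F M X -> martingale F M' X.
Proof.
move=> MM' [aX iX eX]; split=> //.
- by move=> m Q m1 /MM'[N MN NQ]; apply: integrable_agree NQ (iX _ _ m1 MN).
- move=> k m Q km /MM'[N MN NQ]; apply: (ae_agree NQ).
  by rewrite -(cexp_agree _ _ NQ)//; exact: eX.
Qed.

Lemma martingale_supermartingale M X :
  martingale F M X -> supermartingale F M X.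
Proof.
move=> [aX iX eX]; split=> // k m P km MP.
by apply: filterS (eX _ _ _ km MP) => x ->.
Qed.

(** From time [n] on the stopped process is constant and known. *)
Lemma cexp_stopped n X k m P : adapted F X ->
  P.-integrable [set: T] (EFin \o X n) -> (n <= k <= m)%N ->
  {ae P, forall x,
    cexp P (F k) (stopped (cst n) X m) x = stopped (cst n) X k x}.
Proof.
move=> aX iX /andP[nk km].
have eX j : (n <= j)%N -> stopped (cst n) X j = X n.
  by move=> nj; apply/funext => x; rewrite /stopped/= (minn_idPr nj).
rewrite !eX//; last exact: leq_trans km.
apply: (cexp_unique (sF k) (@mF k)); split=> //.
exact: measurable_wrt_sub (@filtration_le _ _ nk) (aX n).
Qed.

Lemma martingale_stopped M n X :
  (forall m P, M P -> P.-integrable [set: T] (EFin \o X m)) ->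
  martingale F M X -> martingale F M (stopped (cst n) X).
Proof.
move=> iX [aX _ eX]; split; first exact: adapted_stopped.
- by move=> m P _ MP; exact: (iX (minn m n)).
- move=> k m P km MP; have [nk|kn] := leqP n k.
    by apply: (cexp_stopped aX (iX n P MP)); rewrite nk.
  have kmn : (k <= minn m n)%N by rewrite leq_min km ltnW.
  apply: filterS (eX _ _ _ kmn MP) => x.
  by rewrite /stopped/= (minn_idPl (ltnW kn)).
Qed.

Lemma supermartingale_stopped M n X :
  (forall m P, M P -> P.-integrable [set: T] (EFin \o X m)) ->
  supermartingale F M X -> supermartingale F M (stopped (cst n) X).
Proof.
move=> iX [aX _ eX]; split; first exact: adapted_stopped.
- by move=> m P _ MP; exact: (iX (minn m n)).
- move=> k m P km MP; have [nk|kn] := leqP n k.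
    have nkm : (n <= k <= m)%N by rewrite nk.
    by apply: filterS (cexp_stopped aX (iX n P MP) nkm) => x ->.
  have kmn : (k <= minn m n)%N by rewrite leq_min km ltnW.
  apply: filterS (eX _ _ _ kmn MP) => x.
  by rewrite /stopped/= (minn_idPl (ltnW kn)).
Qed.

Lemma nondecreasing_stopped M n X :
  nondecreasing_process F M X -> nondecreasing_process F M (stopped (cst n) X).
Proof.
move=> [aX X0 leX]; split; first exact: adapted_stopped.
- by move=> P MP; apply: filterS (X0 _ MP) => x; rewrite /stopped/= min0n.
- move=> m P MP; have [nm|mn] := leqP n m.
    apply: aeW => x.
    by rewrite /stopped/= (minn_idPr nm) (minn_idPr (leqW nm)).
  apply: filterS (leX m _ MP) => x.
  by rewrite /stopped/= (minn_idPl mn) (minn_idPl (ltnW mn)).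
Qed.

Lemma nondecreasing_agree M M' X :
  (forall Q, M' Q -> exists2 N, M N & forall A, measurable A -> N A = Q A) ->
  nondecreasing_process F M X -> nondecreasing_process F M' X.
Proof.
move=> MM' [aX X0 leX]; split=> //.
- by move=> Q /MM'[N MN NQ]; apply: (ae_agree NQ); exact: X0.
- by move=> m Q /MM'[N MN NQ]; apply: (ae_agree NQ); exact: leX.
Qed.

(** Both [f + g] and [f + h] start at [f 0], the first with constant expectation
   and the second with nonincreasing expectation; hence the expectation of
   [h - g >= 0] is at most zero. *)
Lemma martingale_compensator_maximal M f g h : adapted F g -> adapted F h ->
  (forall P, M P -> {ae P, forall x, g 0%N x = 0%R}) ->
  (forall P, M P -> {ae P, forall x, h 0%N x = 0%R}) ->
  (forall P, M P -> P.-integrable [set: T] (EFin \o (f 0%N \+ g 0%N)%R)) ->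
  martingale F M (fun m => f m \+ g m)%R ->
  supermartingale F M (fun m => f m \+ h m)%R ->
  process_le M g h -> process_le M h g.
Proof.
move=> ag ah g0 h0 i0 mart [afh ifh sfh] gh m P m1 MP.
have [afg ifg _] := mart.
have F0T : F 0%N [set: T] by case: hF => _ _ _ ->; right.
have ig := ifg _ _ m1 MP; have ih := ifh _ _ m1 MP.
have mg := adapted_measurable m ag; have mh := adapted_measurable m ah.
have eg : \int[P]_x ((f m \+ g m) x)%:E = \int[P]_x ((f 0%N \+ g 0%N) x)%:E.
  have [_ _ /(_ _ F0T)] := martingale_is_cexp mart ig (leq0n m) MP.
  by move=> <-.
have i0h : P.-integrable [set: T] (EFin \o (f 0%N \+ h 0%N)%R).
  apply: integrable_ae_eq (i0 _ MP); first exact: (adapted_measurable 0 afh).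
  by apply: filterS2 (g0 _ MP) (h0 _ MP) => x /= -> ->.
have le : \int[P]_x ((f m \+ h m) x)%:E <= \int[P]_x ((f m \+ g m) x)%:E.
  rewrite eg; have [mc ic <-//] := cexpP (sF 0%N) (@mF 0%N) ih.
  have -> : \int[P]_x ((f 0%N \+ g 0%N) x)%:E =
      \int[P]_x ((f 0%N \+ h 0%N) x)%:E.
    apply: ae_eq_integral => //.
    + exact: measurable_int (i0 _ MP).
    + exact: measurable_int i0h.
    + by apply: filterS2 (g0 _ MP) (h0 _ MP) => x /= -> ->.
  exact: ae_le_integral ic i0h (sfh _ _ _ (leq0n m) MP).
have mh_g : measurable_fun [set: T] (h m \- g m)%R by exact: measurable_funB.
have ihg : P.-integrable [set: T] (EFin \o (h m \- g m)%R).
  apply: eq_integrable (integrableB measurableT ih ig) => // x _ /=.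
  by rewrite -EFinB; congr EFin; rewrite opprD addrACA subrr add0r.
have h_g0 : {ae P, forall x, [set: T] x -> (0 <= (h m \- g m) x)%R}.
  have /probability1_ge0P := gh _ _ m1 MP.
  by move=> /(_ mh_g); apply: filterS => x + _.
have : {ae P, forall x, [set: T] x -> (h m \- g m)%R x = 0%R}.
  apply: integral_le0_ae_eq0 => //.
  have -> : \int[P]_x ((h m \- g m)%R x)%:E =
      \int[P]_x ((f m \+ h m) x)%:E - \int[P]_x ((f m \+ g m) x)%:E.
    rewrite -integralB_EFin//; apply: eq_integral => x _.
    by rewrite -EFinB; congr EFin; rewrite /= opprD addrACA subrr add0r.
  rewrite sube_le0//; exact: integrable_fin_num ig.
move=> h_g; apply/probability1_ge0P; first exact: measurable_funB.
apply: filterS h_g => x /(_ I).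
by rewrite -[leRHS]opprB /= => ->; rewrite oppr0.
Qed.

End processes.

(** * Maximal chains and mixtures *)

(** Zorn's lemma for the chains that stay chains after [g] is added; a maximal
   one contains [g]. *)
Lemma maximal_chain_through (U : Type) (r : U -> U -> Prop) (G : set U)
    (g : U) :
  G g -> r g g -> exists2 C, maximal_chain r G C & C g.
Proof.
move=> Gg rgg; pose chain C := C `<=` G /\ total_on (C `|` [set g]) r.
have [S SP Stot|C [[CG Ctot] Cmax]] := @Zorn_bigcup U chain.
  split; first by move=> x [C SC Cx]; have [CG _] := SP _ SC; exact: CG.
  move=> x y [[C SC Cx]|->] [[D SD Dy]|->]; last by left.
  - have [CD|DC] := Stot _ _ SC SD.
    + by have [_ tD] := SP _ SD; apply: tD; left => //; exact: CD.
    + by have [_ tC] := SP _ SC; apply: tC; left => //; exact: DC.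
  - by have [_ tC] := SP _ SC; apply: tC; [left|right].
  - by have [_ tD] := SP _ SD; apply: tD; [right|left].
have max D : D `<=` G -> total_on (D `|` [set g]) r -> C `<=` D -> D `<=` C.
  move=> DG Dtot CD; apply: contrapT => nDC.
  by apply: (Cmax D); split.
have Cg : C g.
  apply: (max (C `|` [set g])); last by right.
  - by rewrite subUset; split=> // _ ->.
  - by rewrite -setUA setUid.
  - exact: subsetUl.
have CgE : C `|` [set g] = C by apply/setUidPl => _ ->.
exists C => //; split=> //; first by rewrite -CgE.
move=> D DG Dtot CD; apply: max => //.
by rewrite (_ : D `|` [set g] = D)//; apply/setUidPl => _ ->; exact: CD.
Qed.

(** By induction on the size of the family: the mixture is a convex combination
   of the first measure and of the mixture of the others with weights divided by
   their sum, unless that sum is zero. *)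
Lemma mixtures_convex (d : measure_display) (T : measurableType d)
    (R : realType) (M : set (probability T R)) (s : nat)
    (Ps : 'I_s.+1 -> probability T R) (Q : probability T R) :
  convex_measures M -> (forall i, M (Ps i)) -> mixtures Ps Q ->
  exists2 N, M N & forall A, measurable A -> N A = Q A.
Proof.
move=> Mconv MP [c [c0 c1 cQ]].
suff [N MN NQ] : exists2 N, M N &
    forall A, measurable A -> N A = \sum_i (c i)%:E * Ps i A.
  by exists N => // A mA; rewrite NQ// cQ.
elim: s Ps MP c c0 c1 {Q cQ} => [|s ih] Ps MP c c0 c1.
  exists (Ps ord0) => // A mA; move: c1; rewrite !big_ord1 => ->.
  by rewrite mul1e.
have S0 : (0 <= \sum_(i < s.+1) c (lift ord0 i))%R by apply: sumr_ge0.
move: c1; rewrite big_ord_recl; set S := (\sum_(i < s.+1) _)%R in S0 * => c1.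
have cE : (1 - c ord0 = S)%R by rewrite -c1 addrC addKr.
have [S_eq0|S_neq0] := eqVneq S 0%R.
  have c01 : c ord0 = 1%R by rewrite -c1 S_eq0 addr0.
  exists (Ps ord0) => // A mA.
  move/eqP: S_eq0; rewrite psumr_eq0// => /allP z.
  rewrite big_ord_recl big1 => [|i _]; last first.
    by have /eqP -> := z i (mem_index_enum _); rewrite mul0e.
  by rewrite adde0 c01 mul1e.
have [N MN NE] := ih (fun i => Ps (lift ord0 i)) (fun i => MP _)
  (fun i => (c (lift ord0 i) / S)%R) (fun i => divr_ge0 (c0 _) S0)
  (etrans (esym (mulr_suml _ _ _ _)) (divff S_neq0)).
have [|N' MN' N'E] := Mconv _ _ (MP ord0) MN (c ord0).
  by rewrite c0 -c1 lerDl.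
exists N' => // A mA; rewrite N'E// big_ord_recl; congr (_ + _).
rewrite NE// cE ge0_sume_distrr => [|i _]; last first.
  by rewrite mule_ge0// lee_fin divr_ge0.
apply: eq_bigr => i _; rewrite muleA -EFinM; congr (_%:E * _).
by rewrite mulrC divfK.
Qed.

(** * Simultaneous positivity of conditional expectations *)

Lemma measurable_wrt_bigmin (d : measure_display) (T : measurableType d)
    (R : realType) (G : set (set T)) (I : Type) (r : seq I) (X0 : T -> R)
    (X : I -> T -> R) :
  measurable_wrt G X0 -> (forall i, measurable_wrt G (X i)) ->
  measurable_wrt G (fun x => \big[Order.min/X0 x]_(i <- r) X i x).
Proof.
move=> m0 mX; elim: r => [|i r ih].
  by under eq_fun do rewrite big_nil.
under eq_fun do rewrite big_cons.
exact: measurable_minr (mX i) ih.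
Qed.

(** The bound is the minimum of the [Y i]. On the [G]-set where [Y i <= 0] the
   integral of [X >= 0] is that of [Y i], so [X] is null there, and this holds
   for all the measures at once since they are equivalent. If the minimum were
   almost surely [<= 0], these finitely many sets would cover almost all of the
   space and [X] would be null. *)
Lemma cexp_common_lower_bound (d : measure_display) (T : measurableType d)
    (R : realType) (G : set (set T)) (s : nat)
    (Ps : 'I_s.+1 -> probability T R) (X : T -> R) (Y : 'I_s.+1 -> T -> R) :
  sigma_algebra [set: T] G -> G `<=` measurable ->
  (forall i j, Ps i `<< Ps j) ->
  (forall i, (Ps i).-integrable [set: T] (EFin \o X)) ->
  (forall i, {ae Ps i, forall x, (0 <= X x)%R}) ->
  ~ {ae Ps ord0, forall x, X x = 0%R} ->
  (forall i, is_cexp (Ps i) G X (Y i)) ->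
  exists phi, [/\ measurable_wrt G phi,
    forall i, {ae Ps i, forall x, (0 <= phi x)%R},
    0 < Ps ord0 [set x | (0 < phi x)%R] & forall i x, (phi x <= Y i x)%R].
Proof.
move=> sG GT PsP iX X0 Xn0 cY.
pose phi x := \big[Order.min/Y ord0 x]_i Y i x.
have phiY i x : (phi x <= Y i x)%R by exact: bigmin_le.
have mY i : measurable_wrt G (Y i) by have [] := cY i.
have m0 : measurable_wrt G (cst 0%R : T -> R) by exact: measurable_cst.
have mphi : measurable_wrt G phi by exact: measurable_wrt_bigmin.
exists phi; split=> // [i|].
  have Y0 j : {ae Ps i, forall x, (0 <= Y j x)%R}.
    apply: (ae_dominates (PsP i j)).
    have [_ iY eY] := cY j.
    apply: (ae_le_of_integral sG GT m0 (mY j)) => // [|A GA].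
      exact: integrable0.
    rewrite eY// integral0 -ae_ge0_integral_abs ?integral_ge0//.
    - exact: GT.
    - by apply: measurable_funS (_ : measurable_fun setT X) => //;
        exact/measurable_EFinP/measurable_int/(iX j).
    - by apply: filterS (X0 j).
  apply: filterS (filter_forall _ Y0) => x Yx.
  by apply: le_bigmin.
rewrite lt_neqAle measure_ge0 andbT eq_sym; apply/negP => /eqP/= phi0.
apply: Xn0.
have Gphi := measurable_wrt_lt sG m0 mphi.
have phi_le0 : {ae Ps ord0, forall x, (phi x <= 0)%R}.
  exists [set x | (0 < phi x)%R]; split=> //; first exact: GT.
  by move=> x /= /negP; rewrite -ltNge.
have XY i : {ae Ps ord0, forall x, (Y i x <= 0)%R -> X x = 0%R}.
  apply: (ae_dominates (PsP ord0 i)).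
  have [_ iY eY] := cY i.
  have GA : G [set x | (Y i x <= 0)%R].
    have -> : [set x | (Y i x <= 0)%R] = [set: T] `\` [set x | (0 < Y i x)%R].
      by rewrite setTD; apply/seteqP; split=> x /=; rewrite leNgt => /negP.
    have [_ GC _] := sG; apply: GC; exact: (measurable_wrt_lt sG m0 (mY i)).
  apply: integral_le0_ae_eq0 => //; first exact: GT.
    by apply: filterS (X0 i).
  rewrite -eY// -(integral0 (Ps i) [set x | (Y i x <= 0)%R]).
  have mA := GT _ GA.
  apply: le_integral => //; [by apply: integrableS iY|exact: integrable0|].
  by move=> x; rewrite inE/= lee_fin.
apply: filterS2 (filter_forall _ XY) phi_le0 => x h.
by move=> /bigmin_leP[|[i _]]; exact: h.
Qed.

(** * Supermartingales that are a martingale minus a nondecreasing process *)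

Section decomposition.
Context (d : measure_display) (T : measurableType d) (R : realType).
Variables (F : nat -> set (set T)) (M : set (probability T R)).
Hypotheses (hF : filtration F).
Variables (f mart g0 : nat -> T -> R).
Hypotheses (hf : supermartingale F M f) (hmart : martingale F M mart).
Hypothesis hmart_int :
  forall m P, M P -> P.-integrable [set: T] (EFin \o mart m).
Hypothesis hg0 : nondecreasing_process F M g0.
Hypothesis hdec :
  forall m P, M P -> {ae P, forall x, f m x = (mart m x - g0 m x)%R}.

Let af : adapted F f. Proof. by case: hf. Qed.
Let ag0 : adapted F g0. Proof. by case: hg0. Qed.

(** At time 0 the integrability of [f] comes from that of the martingale, since
   [g0] starts at 0. *)
Lemma supermartingale_integrable m P : M P ->
  P.-integrable [set: T] (EFin \o f m).
Proof.
move=> MP; have [_ iF _] := hf; case: m => [|m]; last exact: iF.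
have [_ /(_ _ MP) g00 _] := hg0.
apply: integrable_ae_eq (hmart_int 0%N MP).
  exact (adapted_measurable hF 0%N af).
by apply: filterS2 (hdec 0%N MP) g00 => x -> ->; rewrite subr0.
Qed.

Lemma compensator_integrable m P : M P ->
  P.-integrable [set: T] (EFin \o g0 m).
Proof.
move=> MP; apply: (@integrable_ae_eq _ _ _ _ (mart m \- f m)%R).
- exact (adapted_measurable hF m ag0).
- by apply: filterS (hdec m MP) => x /= ->; rewrite subKr.
- by apply: eq_integrable (integrableB measurableT (hmart_int m MP)
    (supermartingale_integrable m MP)).
Qed.

(** Conditioning [f = mart - g0] at time [m] makes the martingale part cancel, so
   that only the increment of [g0] contributes to the decrease of [f]. *)
Lemma is_cexp_decrease m P : M P ->
  is_cexp P (F m) (g0 m.+1 \- g0 m)%R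
    (f m \- cexp P (F m) (f m.+1))%R.
Proof.
move=> MP.
have FT : F m `<=` measurable by exact: filtration_measurable.
have iF k := supermartingale_integrable k MP.
have ig k := compensator_integrable k MP.
have [mc ic ec] := cexpP (filtration_sigma hF m) FT (iF m.+1).
split; first exact: (measurable_funB (@af m) mc).
  by apply: eq_integrable (integrableB measurableT (iF m) ic).
move=> A FA; have mA := FT _ FA.
have iS Z : P.-integrable [set: T] (EFin \o Z) ->
    P.-integrable A (EFin \o Z) by apply: integrableS.
have ef k : \int[P]_(x in A) (f k x)%:E =
    \int[P]_(x in A) (mart k x)%:E - \int[P]_(x in A) (g0 k x)%:E.
  have im := iS _ (hmart_int k MP); have igA := iS _ (ig k).
  rewrite -integralB_EFin//.
  apply: ae_eq_integral => //.
  - exact: measurable_int (iS _ (iF k)).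
  - exact: measurable_int (integrableB mA im igA).
  - by apply: filterS (hdec k MP) => x /= ->.
have em : \int[P]_(x in A) (mart m x)%:E = \int[P]_(x in A) (mart m.+1 x)%:E.
  have [_ _ /(_ _ FA)] :=
    martingale_is_cexp hF hmart (hmart_int m.+1 MP) (leqnSn m) MP.
  by [].
under eq_integral do rewrite /= EFinB.
under [RHS]eq_integral do rewrite /= EFinB.
rewrite !integralB_EFin//; try exact: iS.
rewrite ec// !ef em.
have fin Z : P.-integrable [set: T] (EFin \o Z) ->
    \int[P]_(x in A) (Z x)%:E \is a fin_num.
  by move=> iZ; apply: integrable_fin_num => //; exact: iS.
rewrite -(fineK (fin _ (hmart_int m.+1 MP))) -(fineK (fin _ (ig m))).
rewrite -(fineK (fin _ (ig m.+1))) -!EFinB; congr EFin.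
by rewrite opprB [LHS]addrC addrA subrK.
Qed.

Lemma not_martingale_jump : ~ martingale F M f ->
  exists m P, M P /\ ~ {ae P, forall x, g0 m.+1 x = g0 m x}.
Proof.
move=> nmart; apply: contrapT => nojump; apply: nmart.
have jump m P : M P -> {ae P, forall x, g0 m.+1 x = g0 m x}.
  by move=> MP; apply: contrapT => j; apply: nojump; exists m, P.
apply: (martingale_ae hF af _ hmart) => m P MP.
have g_eq0 : {ae P, forall x, g0 m x = 0%R}.
  elim: m => [|m ih]; first by have [_ /(_ _ MP)] := hg0.
  by apply: filterS2 (jump m _ MP) ih => x -> ->.
by apply: filterS2 (hdec m MP) g_eq0 => x -> ->; rewrite subr0.
Qed.

Lemma stopped_dominated n : bounded_means M f ->
  exists (phi : T -> R) (t : R), [/\ measurable_fun [set: T] phi,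
    forall m P, M P -> {ae P, forall x, (`|stopped (cst n) f m x| <= phi x)%R} &
    forall P, M P -> 'E_P[phi] < t%:E].
Proof.
move=> bnd.
pose b i := ereal_sup [set 'E_P[fun x => `|f i x|%R] | P in M].
have mf i : measurable_fun [set: T] (fun x => `|f i x|%R).
  by apply: measurableT_comp => //; exact (adapted_measurable hF i af).
(* The added 1 makes the bound strict. *)
exists (fun x => \sum_(i < n.+1) `|f i x|)%R.
exists (\sum_(i < n.+1) fine (b i) + 1)%R.
split.
- exact: measurable_sum.
- move=> m P MP; apply: aeW => x; rewrite /stopped/=.
  have lt : (minn m n < n.+1)%N by rewrite ltnS geq_minr.
  rewrite (bigD1 (Ordinal lt))//= lerDl; exact: sumr_ge0.
- move=> P MP; rewrite unlock.
  under eq_integral do rewrite -sumEFin.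
  rewrite ge0_integral_sum//; last by move=> i; exact/measurable_EFinP.
  apply: (@le_lt_trans _ _ (\sum_(i < n.+1) fine (b i))%:E); last first.
    by rewrite lte_fin ltrDl.
  rewrite -sumEFin; apply: lee_sum => i _.
  have le : \int[P]_x `|f i x|%:E <= b i.
    by apply: ereal_sup_ubound; exists P => //; rewrite unlock.
  rewrite fineK// ge0_fin_numE; first exact: bnd.
  by apply: le_trans le; exact: integral_ge0.
Qed.

Local Notation stop n X := (stopped (cst n) X).

Lemma stopped_decomposition n m P : M P ->
  {ae P, forall x, stop n mart m x = (stop n f m \+ stop n g0 m)%R x}.
Proof.
move=> MP; apply: filterS (hdec (minn m n) MP) => x.
by rewrite /stopped/= => ->; rewrite subrK.
Qed.

Hypotheses (hconv : convex_measures M) (hequiv : equivalent_measures M).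

Lemma stopped_strict_decrease n m s (Ps : 'I_s.+1 -> probability T R) :
  (m < n)%N -> (forall i, M (Ps i)) ->
  (exists P, M P /\ ~ {ae P, forall x, g0 m.+1 x = g0 m x}) ->
  strict_decrease F Ps (stop n f).
Proof.
move=> mn MP [P [MP0 jump]].
have stopE k : (k <= n)%N -> stop n f k = f k.
  by move=> kn; apply/funext => x; rewrite /stopped/= (minn_idPl kn).
have [phi [mphi phi0 phi_gt0 phi_le]] : exists phi,
    [/\ measurable_wrt (F m) phi,
    forall i, {ae Ps i, forall x, (0 <= phi x)%R},
    0 < Ps ord0 [set x | (0 < phi x)%R] &
    forall i x, (phi x <= (f m \- cexp (Ps i) (F m) (f m.+1))%R x)%R].
  apply: (@cexp_common_lower_bound _ _ _ _ _ _ (g0 m.+1 \- g0 m)%R).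
  - exact: filtration_sigma.
  - exact: filtration_measurable.
  - by move=> i j; apply: hequiv.
  - move=> i; have ig k := compensator_integrable k (MP i).
    by apply: eq_integrable (integrableB measurableT (ig m.+1) (ig m)).
  - move=> i; have [_ _ /(_ m _ (MP i))] := hg0.
    by apply: filterS => x; rewrite /= subr_ge0.
  - move=> h; apply: jump; apply: ae_dominates (hequiv MP0 (MP ord0)) _.
    by apply: filterS h => x /= /eqP; rewrite subr_eq0 => /eqP.
  - by move=> i; exact: is_cexp_decrease.
exists m.+1, phi; split=> // i.
by rewrite /= !stopE//; [apply: aeW => x; exact: phi_le|exact: ltnW].
Qed.

(** The increments of the maximal element [stop n g0] are the prescribed process
   itself, so their conditional expectations are the same functions. *)
Lemma stopped_compensated n s (Ps : 'I_s.+1 -> probability T R) :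
  (forall i, M (Ps i)) ->
  compensated F Ps (stop n f) (fun m => stop n g0 m \- stop n g0 m.-1)%R.
Proof.
move=> MP.
have mixM Q : mixtures Ps Q ->
    exists2 N, M N & forall A, measurable A -> N A = Q A.
  exact: mixtures_convex hconv MP.
have asf : adapted F (stop n f) by exact: adapted_stopped.
have asg : adapted F (stop n g0) by exact: adapted_stopped.
have martM : martingale F M (fun m => stop n f m \+ stop n g0 m)%R.
  apply: (martingale_ae hF _ _ (martingale_stopped hF n hmart_int hmart)).
    by move=> m; exact (measurable_funD (asf m) (asg m)).
  by move=> m P; exact: stopped_decomposition.
have martQ := martingale_agree mixM martM.
have ndg : nondecreasing_process F (mixtures Ps) (stop n g0).
  exact: nondecreasing_agree mixM (nondecreasing_stopped hF n hg0).
have Gg : compensators F Ps (stop n f) (stop n g0).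
  by split=> //; exact: martingale_supermartingale.
have gg : process_le (mixtures Ps) (stop n g0) (stop n g0).
  move=> m Q _ _; rewrite (_ : [set x | _] = setT) ?probability_setT//.
  by apply/seteqP; split=> // x _ /=; rewrite subrr.
have [C maxC Cg] := maximal_chain_through Gg gg.
exists C, (stop n g0); split=> //.
- split=> // h Ch.
  have [CG _ _] := maxC; have [[ah h0 _] sh] := CG _ Ch.
  have [_ g00 _] := ndg.
  apply: (martingale_compensator_maximal hF (f := stop n f)) => //.
  move=> Q /mixM[N MN NQ].
  apply: (integrable_agree NQ).
  apply: (integrable_ae_eq _ (stopped_decomposition n 0%N MN)
    (hmart_int (minn 0 n) MN)).
  exact: measurable_funD (adapted_measurable hF 0%N asf)
    (adapted_measurable hF 0%N asg).
- move=> i k m km m1; have [_ _ h] := martM; exact: h.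
- by move=> i m m1; exact: aeW.
Qed.

Lemma stopped_regular n m : bounded_means M f -> (m < n)%N ->
  (exists P, M P /\ ~ {ae P, forall x, g0 m.+1 x = g0 m x}) ->
  regular_supermartingale F M (stop n f).
Proof.
move=> bnd mn jump; split=> //.
- exact: (supermartingale_stopped hF n supermartingale_integrable hf).
- exact: stopped_dominated.
have asg : adapted F (stop n g0) by exact: adapted_stopped.
exists (fun k => stop n g0 k \- stop n g0 k.-1)%R; split.
- move=> k; apply: measurable_funB (asg k) _.
  exact: (measurable_wrt_sub (filtration_le hF (leq_pred k)) (asg k.-1)).
- move=> k P MP; case: k => [|k]; first by apply: aeW => x /=; rewrite subrr.
  have [_ _ /(_ k _ MP)] := nondecreasing_stopped hF n hg0.
  by apply: filterS => x /=; rewrite subr_ge0.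
- by move=> P MP; apply: aeW => x /=; rewrite subrr.
- move=> k P _ MP; have ig j := compensator_integrable (minn j n) MP.
  by apply: eq_integrable (integrableB measurableT (ig k) (ig k.-1)).
- move=> s Ps MPs _; split; last exact: stopped_compensated.
  exact: stopped_strict_decrease mn MPs jump.
Qed.

End decomposition.

Local Close Scope ereal_scope.

(* hproper: regularity demands a strictly positive decrease of f somewhere, so a
   martingale is never local regular (for nonempty M). *)
Theorem theorem6 (d : measure_display) (T : measurableType d) (R : realType)
    (F : nat -> set (set T)) (hF : filtration F)
    (M : set (probability T R))
    (hconv : convex_measures M) (hequiv : equivalent_measures M)
    (f : nat -> T -> R) (hf : supermartingale F M f) (hsup : bounded_means M f)
    (hproper : ~ martingale F M f)
    (mart : nat -> T -> R) (hmart : martingale F M mart)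
    (hmart_int : forall m P, M P -> P.-integrable [set: T] (EFin \o mart m))
    (g0 : nat -> T -> R) (hg0 : nondecreasing_process F M g0)
    (hdec : forall m P, M P -> {ae P, forall x, f m x = mart m x - g0 m x}) :
  local_regular F M f.
Proof.
have [m [P jump]] := not_martingale_jump hF hf hmart hg0 hdec hproper.
split=> //; exists (fun s => m.+1 + s)%N; split.
- by move=> s t; rewrite ltn_add2l.
- exact: cvg_addnl.
- move=> s; apply: (stopped_regular hF hf hmart hmart_int hg0 hdec hconv hequiv
    (m := m)) => //.
    by rewrite ltnS leq_addr.
  by exists P.
Qed.
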